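(* Let $\mathcal C=(F_v,F_e,\mathcal T)$ be a crystal framework in $\mathbb R^d$ with given translational periodicity $\mathcal T$ and let $\mathcal E\subset M_d(\mathbb R)$ be a linear space of affine velocity matrices. Then $$m_{\mathcal E}-s_{\mathcal E}=d|F_v|+\dim\mathcal E-|F_e|-f_{\mathcal E},$$ where $m_{\mathcal E}$ is the dimension of the space of non rigid motion $\mathcal E$-affinely periodic infinitesimal flexes, $s_{\mathcal E}$ is the dimension of the space of periodic self-stresses for $\mathcal C$ and $\mathcal E$, and $f_{\mathcal E}$ is the dimension of the space of infinitesimal affinely periodic rigid motions with affine velocity matrix in $\mathcal E$.
   Context: A full rank translation group on $\mathbb R^d$ is a set $\mathcal T=\{T_k:k\in\mathbb Z^d\}$ of translations with $T_{k+l}=T_kT_l$ whose period vectors $a_i=T_{\gamma_i}0$ ($\gamma_1,\dots,\gamma_d$ the standard basis) are linearly independent. $Z$ is the invertible matrix with $Z\gamma_i=a_i$, so $T_kx=x+Zk$. A crystal framework $\mathcal C=(F_v,F_e,\mathcal T)$ in $\mathbb R^d$, with motif $\mathcal M=(F_v,F_e)$, is a countable bar-joint framework (framework points in $\mathbb R^d$ together with framework edges, which are line segments of positive length joining certain pairs of framework points) whose framework points are $p_{\kappa,k}=T_kp_{\kappa,0}$, $1\le\kappa\le t$, $k\in\mathbb Z^d$, such that $F_v=\{p_{\kappa,0}\}$, $F_e$ is a finite set of framework edges, the set of framework points is the disjoint union of the $T_k(F_v)$ and the set of framework edges is the disjoint union of the $T_k(F_e)$. Each $e\in F_e$ is written $e=[p_{\kappa,0},p_{\tau,\delta(e)}]$,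 with exponent $\delta(e)=(\delta_1,\dots,\delta_d)\in\mathbb Z^d$ and edge vector $v_e=p_{\kappa,0}-p_{\tau,\delta(e)}$. The affinely periodic rigidity matrix $R(\mathcal M,\mathbb R^{d^2})$ is the $|F_e|\times(d|F_v|+d^2)$ real matrix whose row for $e$ has $v_e$ in the $d$ columns for $\kappa$, $-v_e$ in the $d$ columns for $\tau$ (zero in these columns if $\kappa=\tau$), zeros in the other vertex columns, and $(\delta_1v_e,\dots,\delta_dv_e)$ in the last $d^2$ columns. A pair $(u,A)$ with $u=(u_\kappa)\in\mathbb R^{d|F_v|}$ and $A\in M_d(\mathbb R)$ determines the affinely periodic velocity vector $\tilde u_{\kappa,k}=u_\kappa-AZk$ on the framework points. Pairs $(u,A)$ are identified with vectors $(u,AZ)\in\mathbb R^{d|F_v|}\oplus\mathbb R^{d^2}$, where $AZ$ is written as its $d$ columns in order. For a linear space $\mathcal E$ of $d\times d$ matrices, $R(\mathcal M,\mathcal E):\mathbb R^{d|F_v|}\oplus\mathcal E\to\mathbb R^{|F_e|}$ is the restriction $(u,A)\mapsto R(\mathcal M,\mathbb R^{d^2})(u,AZ)$, $A\in\mathcal E$. Put $\mathcal H_{\rm fl}^{\mathcal E}=\ker R(\mathcal M,\mathcal E)$ (the $\mathcal E$-affinely periodic infinitesimal flexes). $\mathcal H_{\rm rig}^{\mathcal E}$ is the subspace of those pairs $(u,A)$, $A\in\mathcal E$, for which $\tilde u$ is a rigid motion infinitesimal flex, i.e. is induced by isometries of $\mathbb R^d$: $\tilde u_{\kappa,k}=c+Sp_{\kappa,k}$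 for some $c\in\mathbb R^d$ and some skew-symmetric $S$. $\mathcal H_{\rm mech}^{\mathcal E}=\mathcal H_{\rm fl}^{\mathcal E}\ominus\mathcal H_{\rm rig}^{\mathcal E}$ (orthogonal complement). The space $\mathcal H_{\rm str}^{\mathcal E}$ of periodic self-stresses for $\mathcal C$ and $\mathcal E$ is the cokernel of $R(\mathcal M,\mathcal E)$, i.e. the orthogonal complement of its range in $\mathbb R^{|F_e|}$. Then $m_{\mathcal E}=\dim\mathcal H_{\rm mech}^{\mathcal E}$, $s_{\mathcal E}=\dim\mathcal H_{\rm str}^{\mathcal E}$, $f_{\mathcal E}=\dim\mathcal H_{\rm rig}^{\mathcal E}$. *)

(* Defs.v *)
From HB Require Import structures.
From mathcomp Require Import all_boot all_order all_algebra.
From mathcomp Require Import all_classical all_reals.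

Set Implicit Arguments.
Unset Strict Implicit.
Unset Printing Implicit Defensive.

Import Order.TTheory GRing.Theory Num.Theory.
Local Open Scope classical_set_scope.
Local Open Scope ring_scope.

(* The subspace whose elements are exactly those satisfying P; it is a junk
   value unless P is closed under linear combinations, see mem_vspace_of. *)
Definition vspace_of (K : fieldType) (V : vectType K) (P : set V) : {vspace V} :=
  xget 0%VS [set U : {vspace V} | forall v, (v \in U) <-> P v].

Lemma mem_vspace_of (K : fieldType) (V : vectType K) (P : set V) :
  P 0 -> (forall a x y, P x -> P y -> P (a *: x + y)) ->
  forall v, (v \in vspace_of P) <-> P v.
Proof.
move=> P0 Plin.
suff [U HU] : exists U : {vspace V}, forall v, (v \in U) <-> P v.
  by rewrite /vspace_of; case: xgetP => [W _ //|/(_ U)]; case.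
pose Q n := `[< exists U : {vspace V}, \dim U = n /\ forall v, v \in U -> P v >].
have exQ : exists n, Q n.
  exists 0%N; apply/asboolP; exists 0%VS; split; first exact: dimv0.
  by move=> v; rewrite memv0 => /eqP ->.
have leQ n : Q n -> (n <= \dim {:V})%N.
  by move=> /asboolP [U [<- _]]; apply: dimvS; exact: subvf.
case: (ex_maxnP exQ leQ) => n /asboolP [U [dU UP]] maxn.
exists U => v; split; first exact: UP.
move=> Pv.
have QW : Q (\dim (<[v]> + U)%VS).
  apply/asboolP; exists (<[v]> + U)%VS; split=> // w.
  by move=> /memv_addP [x /vlineP [a ->] [y /UP Py ->]]; exact: Plin.
have eqU : U = (<[v]> + U)%VS.
  by apply/eqP; rewrite eqEdim addvSr /= dU; exact: maxn.
by rewrite eqU; apply: (subvP (addvSl _ _)); exact: memv_line.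
Qed.

Section Frameworks.
Variables (R : realType) (d : nat).
Notation point := 'cV[R]_d.

Definition is_translation (f : point -> point) : Prop :=
  exists c, forall x, f x = x + c.

Definition segment (p q : point) : set point :=
  [set x | exists2 s : R, 0 <= s <= 1 & x = (1 - s) *: p + s *: q].

Record translation_group := TranslationGroup {
  trans :> 'cV[int]_d -> point -> point;
  trans_translation : forall k, is_translation (trans k);
  transD : forall k l x, trans (k + l) x = trans k (trans l x);
  trans_free : free [seq trans (delta_mx i 0) 0 | i <- enum 'I_d]
}.

Definition period_matrix (T : translation_group) : 'M[R]_d :=
  \matrix_(i, j) T (delta_mx j 0) 0 i 0.

Record framework := Framework {
  fpoints : set point;
  fedges : set (set point);
  fpoints_countable : countable fpoints;
  fedges_segment : forall e, fedges e ->
    exists p q, [/\ fpoints p, fpoints q, p != q & e = segment p q]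
}.

(* The motif is indexed without repetition: F_v = { p0 i | i < nv } and
   F_e = { [p0 (src e), T_(expo e) (p0 (tgt e))] | e < ne }. *)
Record crystal_framework := CrystalFramework {
  cf_framework :> framework;
  cf_trans : translation_group;
  nv : nat;
  ne : nat;
  p0 : 'I_nv -> point;
  src : 'I_ne -> 'I_nv;
  tgt : 'I_ne -> 'I_nv;
  expo : 'I_ne -> 'cV[int]_d;
  motif_edge := fun e : 'I_ne =>
    segment (p0 (src e)) (cf_trans (expo e) (p0 (tgt e)));
  p0_inj : injective p0;
  motif_edge_inj : injective motif_edge;
  cf_points : fpoints cf_framework = \bigcup_k (cf_trans k @` range p0);
  cf_points_disjoint : trivIset setT (fun k => cf_trans k @` range p0);
  cf_edges : fedges cf_framework =
    \bigcup_k [set cf_trans k @` s | s in range motif_edge];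
  cf_edges_disjoint :
    trivIset setT (fun k => [set cf_trans k @` s | s in range motif_edge])
}.

Section Rigidity.
Variable C : crystal_framework.
Notation Z := (period_matrix (cf_trans C)).

Definition fpoint (i : 'I_(nv C)) (k : 'cV[int]_d) : point :=
  cf_trans C k (p0 i).

Definition edge_vector (e : 'I_(ne C)) : point :=
  fpoint (src e) 0 - fpoint (tgt e) (expo e).

(* Column blocks: d columns for each vertex, then d blocks of d columns; the
   rows of the matrices below are these blocks. *)
Definition vertex_block (e : 'I_(ne C)) : 'M[R]_(nv C, d) :=
  \matrix_(i, j)
    if src e == tgt e then 0
    else if i == src e then edge_vector e j 0
    else if i == tgt e then - edge_vector e j 0
    else 0.

Definition affine_block (e : 'I_(ne C)) : 'M[R]_(d, d) :=
  \matrix_(i, j) ((expo e i 0)%:~R * edge_vector e j 0).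

Definition rigidity_matrix : 'M[R]_(ne C, nv C * d + d * d) :=
  \matrix_(e < ne C) row_mx (mxvec (vertex_block e)) (mxvec (affine_block e)).

Section Restricted.
Variable E : {vspace 'M[R]_d}.

(* A pair (u, A), where u_i is column i of u and A lies in E. *)
Notation velocity := ('M[R]_(d, nv C) * subvs_of E)%type.

(* The vector (u, AZ); transposes because mxvec lists a matrix row by row. *)
Definition velocity_coords (x : velocity) : 'cV[R]_(nv C * d + d * d) :=
  (row_mx (mxvec x.1^T) (mxvec (vsval x.2 *m Z)^T))^T.

Definition velocity_at (x : velocity) (i : 'I_(nv C)) (k : 'cV[int]_d) : point :=
  col i x.1 - vsval x.2 *m Z *m map_mx intr k.

Definition rigidity_fun (x : velocity) : 'cV[R]_(ne C) :=
  rigidity_matrix *m velocity_coords x.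

Lemma velocity_coords_is_linear : linear velocity_coords.
Proof.
move=> a x y; rewrite /velocity_coords /= linearP /= mulmxDl -scalemxAl.
by rewrite !linearP /= -add_row_mx -scale_row_mx linearP.
Qed.
HB.instance Definition _ := GRing.isLinear.Build R velocity
  'cV[R]_(nv C * d + d * d) *:%R velocity_coords velocity_coords_is_linear.

Lemma rigidity_fun_is_linear : linear rigidity_fun.
Proof.
by move=> a x y; rewrite /rigidity_fun linearP mulmxDr scalemxAr.
Qed.
HB.instance Definition _ := GRing.isLinear.Build R velocity
  'cV[R]_(ne C) *:%R rigidity_fun rigidity_fun_is_linear.

Definition rigidity_map : 'Hom(velocity, 'cV[R]_(ne C)) := linfun rigidity_fun.

Definition dotc n (x y : 'cV[R]_n) : R := \sum_i x i 0 * y i 0.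

Definition flex_space : {vspace velocity} := lker rigidity_map.

Definition is_rigid_motion (x : velocity) : Prop :=
  exists (c : point) (S : 'M[R]_d), S^T = - S /\
    forall i k, velocity_at x i k = c + S *m fpoint i k.

Definition rigid_space : {vspace velocity} := vspace_of is_rigid_motion.

Definition mech_space : {vspace velocity} :=
  vspace_of [set x | x \in flex_space /\
    forall y, y \in rigid_space ->
      dotc (velocity_coords x) (velocity_coords y) = 0].

Definition stress_space : {vspace 'cV[R]_(ne C)} :=
  vspace_of [set w | forall z, z \in limg rigidity_map -> dotc w z = 0].

Definition mech_dim : nat := \dim mech_space.
Definition stress_dim : nat := \dim stress_space.
Definition rigid_dim : nat := \dim rigid_space.

Lemma dotc_linearl n a (x y z : 'cV[R]_n) :
  dotc (a *: x + y) z = a * dotc x z + dotc y z.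
Proof.
rewrite /dotc mulr_sumr -big_split /=; apply: eq_bigr => i _.
by rewrite !mxE mulrDl mulrA.
Qed.

Lemma dotc0l n (z : 'cV[R]_n) : dotc 0 z = 0.
Proof. by rewrite /dotc big1 // => i _; rewrite mxE mul0r. Qed.

Lemma mem_rigid_space x : (x \in rigid_space) <-> is_rigid_motion x.
Proof.
apply: mem_vspace_of.
  exists 0, 0; split; first by rewrite trmx0 oppr0.
  by move=> i k; rewrite /velocity_at /= col0 !mul0mx subr0 addr0.
move=> a y z [c [S [Sk H]]] [c' [S' [Sk' H']]].
exists (a *: c + c'), (a *: S + S'); split.
  by rewrite linearP /= Sk Sk' scalerN opprD.
move=> i k.
have -> : velocity_at (a *: y + z) i k =
    a *: velocity_at y i k + velocity_at z i k.
  rewrite /velocity_at /= !linearP /= !mulmxDl -!scalemxAl scalerBr opprD.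
  by rewrite addrACA.
by rewrite H H' mulmxDl -scalemxAl scalerDr addrACA.
Qed.

Lemma mem_mech_space x : (x \in mech_space) <->
  x \in flex_space /\ forall y, y \in rigid_space ->
    dotc (velocity_coords x) (velocity_coords y) = 0.
Proof.
apply: mem_vspace_of => /=.
  by split=> [|y _]; rewrite ?mem0v // linear0 dotc0l.
move=> a y z [Fy Oy] [Fz Oz]; split; first by rewrite memvD // memvZ.
by move=> w Hw; rewrite linearP dotc_linearl Oy // Oz // mulr0 addr0.
Qed.

Lemma mem_stress_space w : (w \in stress_space) <->
  forall z, z \in limg rigidity_map -> dotc w z = 0.
Proof.
apply: mem_vspace_of => /= [z _|a x y Ox Oy z Hz]; first exact: dotc0l.
by rewrite dotc_linearl Ox // Oy // mulr0 addr0.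
Qed.

End Restricted.
End Rigidity.
End Frameworks.

(* Main.v *)
From HB Require Import structures.
Require Import Defs.
From mathcomp Require Import all_boot all_order all_algebra.
From mathcomp Require Import all_classical all_reals.
From mathcomp Require Import ring.

(** Both sides count dimensions, and the formula is the rank-nullity theorem
    for the rigidity map once two orthogonal complements have been counted.

    Nullity: the mechanisms are the orthogonal complement, inside the kernel,
    of the rigid motions, so [mech_dim + rigid_dim] is the nullity.  This uses
    that rigid motions are flexes ([rigid_space_sub_flex]): along an edge, the
    relative velocity of a rigid motion is [S v_e] with [S] skew-symmetric, and
    [v_e] is orthogonal to it.
    Rank: the stresses are the orthogonal complement of the range, so
    [stress_dim] plus the rank is the number of edges.

    The mechanisms are cut out by the Euclidean product of the coordinate
    vectors [(u, AZ)], which is definite on the pairs [(u, A)] because the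
    period matrix [Z] is invertible ([velocity_coords_inj]): this is where the
    linear independence of the period vectors enters.  Both complements are
    then counted by [dim_orthogonal_complement]. *)

Set Implicit Arguments.
Unset Strict Implicit.
Unset Printing Implicit Defensive.

Import Order.TTheory GRing.Theory Num.Theory.
Local Open Scope ring_scope.

Section DotProduct.
Variables (R : realType).

Lemma dotcC n (x y : 'cV[R]_n) : dotc x y = dotc y x.
Proof. by apply: eq_bigr => i _; rewrite mulrC. Qed.

Lemma dotc_eq0 n (x : 'cV[R]_n) : dotc x x = 0 -> x = 0.
Proof.
move=> /eqP; rewrite psumr_eq0 => [/allP x0|i _]; last exact: sqr_ge0.
apply/matrixP => i j; rewrite ord1 mxE; apply/eqP.
by have := x0 i (mem_index_enum i); rewrite mulf_eq0 orbb.
Qed.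

Lemma dotcE n (x y : 'cV[R]_n) : dotc x y = (x^T *m y) 0 0.
Proof. by rewrite mxE; apply: eq_bigr => i _; rewrite mxE. Qed.

(** Transposing the scalar [v^T S v] changes its sign. *)
Lemma dotc_skew n (S : 'M[R]_n) (v : 'cV[R]_n) :
  S^T = - S -> dotc v (S *m v) = 0.
Proof.
move=> skewS; have : dotc v (S *m v) = - dotc v (S *m v).
  rewrite {1}dotcC !dotcE trmx_mul skewS mulmxN mulNmx -mulmxA.
  by rewrite mxE.
by move=> /eqP; rewrite -addr_eq0 -mulr2n mulrn_eq0 /= => /eqP.
Qed.

(** Being orthogonal to [U] amounts to [\dim U] linear equations, one for each
    vector of a basis, so the complement has dimension at least
    [\dim F - \dim U]; and it meets [U] only in [0] because the pulled back
    product is definite, so it has dimension at most that. *)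
Lemma dim_orthogonal_complement (V : vectType R) n
    (g : {linear V -> 'cV[R]_n}) (F U W : {vspace V}) :
  injective g -> (U <= F)%VS ->
  (forall x, (x \in W) <->
     x \in F /\ forall y, y \in U -> dotc (g x) (g y) = 0) ->
  (\dim W + \dim U)%N = \dim F.
Proof.
move=> g_inj UF memW.
pose phi_fun (x : V) : 'rV[R]_(\dim U) :=
  \row_j dotc (g x) (g (vbasis U)`_j).
have phi_lin : linear phi_fun.
  by move=> a x y; apply/rowP => j; rewrite !mxE linearP dotc_linearl.
pose phiL : {linear V -> 'rV[R]_(\dim U)} :=
  HB.pack phi_fun (GRing.isLinear.Build R V _ _ phi_fun phi_lin).
have WE : W = (F :&: lker (linfun phiL))%VS.
  apply/vspaceP => x; rewrite memv_cap memv_ker lfunE /=.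
  apply/idP/andP => [/memW[xF xU]|[xF /eqP x0]].
    split=> //; apply/eqP/rowP => j; rewrite !mxE xU //.
    by apply: vbasis_mem; apply: mem_nth; rewrite size_tuple.
  apply/memW; split=> // y /coord_vbasis ->; rewrite linear_sum dotcC.
  rewrite (big_morph (fun z => dotc z (g x)) (id1 := 0) (op1 := +%R)).
  - apply: big1 => j _; rewrite linearZ /= -[_ *: _]addr0 dotc_linearl dotc0l.
    by move/rowP/(_ j): x0; rewrite !mxE dotcC => ->; rewrite mulr0 addr0.
  - by move=> a b; rewrite -[a]scale1r dotc_linearl mul1r scale1r.
  - exact: dotc0l.
have WU0 : (W :&: U = 0)%VS.
  apply/eqP; rewrite -subv0; apply/subvP => x /memv_capP[/memW[_ xU] /xU].
  by move=> /dotc_eq0; rewrite -(linear0 g) => /g_inj ->; rewrite mem0v.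
apply/eqP; rewrite eqn_leq; apply/andP; split.
  rewrite -dimv_disjoint_sum //; apply: dimvS; rewrite subv_add UF andbT.
  by rewrite WE capvSl.
rewrite -(limg_ker_dim (linfun phiL) F) WE leq_add2l.
by apply: leq_trans (dimvS (subvf _)) _; rewrite dimvf /dim /= mul1n.
Qed.

End DotProduct.

Section Rigidity.
Variables (R : realType) (d : nat) (C : crystal_framework R d).
Notation Z := (period_matrix (cf_trans C)).

Lemma period_matrix_unit : Z \in unitmx.
Proof.
rewrite -unitmx_tr -row_free_unit; apply/inj_row_free => v vZ.
have fr := trans_free (cf_trans C).
set s := [seq _ | _ <- _] in fr.
have sz : size s = d by rewrite size_map size_enum_ord.
have /freeP fr' : free (Tuple (introT eqP sz)) by [].
apply/rowP => i; rewrite mxE.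
apply: (fr' (fun j => v 0 j)).
apply/colP => k; have /rowP/(_ k) := vZ; rewrite !mxE summxE => vk.
rewrite -[RHS]vk; apply: eq_bigr => j _; rewrite !mxE /=; congr (_ * _).
by rewrite (nth_map j) ?size_enum_ord // nth_ord_enum.
Qed.

Variable E : {vspace 'M[R]_d}.

Lemma velocity_coords_inj : injective (velocity_coords (C := C) (E := E)).
Proof.
move=> [u A] [v B] /trmx_inj /eq_row_mx /= [].
move=> /(can_inj mxvecK)/trmx_inj -> /(can_inj mxvecK)/trmx_inj AB.
congr (_, _); apply: val_inj.
by rewrite -[LHS](mulmxK period_matrix_unit) AB (mulmxK period_matrix_unit).
Qed.

Lemma row_mxvec_mulmx m n (A B : 'M[R]_(m, n)) :
  (mxvec A *m (mxvec B)^T) 0 0 = \sum_i \sum_j A i j * B i j.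
Proof.
rewrite mxE pair_bigA /= (reindex _ (curry_mxvec_bij _ _)) /=.
by apply: eq_bigr => -[i j] _; rewrite mxE !mxvecE.
Qed.

(** Each row of the rigidity matrix tests the relative velocity of the two end
    points of an edge against the direction of the edge.  When the end points
    are translates of the same motif point, the zero vertex columns agree with
    the cancellation of the two equal [u] terms in that relative velocity. *)
Lemma rigidity_fun_edge (x : 'M[R]_(d, nv C) * subvs_of E) (e : 'I_(ne C)) :
  rigidity_fun x e 0 =
  dotc (edge_vector e)
    (velocity_at x (src e) 0 - velocity_at x (tgt e) (expo e)).
Proof.
case: x => u A; rewrite /rigidity_fun /velocity_coords /velocity_at /=.
set B := _ *m Z; set v := edge_vector e.
have -> (w : 'cV[R]_(nv C * d + d * d)) :
    (rigidity_matrix C *m w) e 0 =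
    (row_mx (mxvec (vertex_block e)) (mxvec (affine_block e)) *m w) 0 0.
  by rewrite !mxE; apply: eq_bigr => j _; rewrite mxE.
rewrite tr_row_mx mul_row_col mxE !row_mxvec_mulmx.
have -> : map_mx intr (0 : 'cV[int]_d) = 0 :> 'cV[R]_d.
  by apply/matrixP => i j; rewrite !mxE.
rewrite mulmx0 subr0 opprB [_ *m _ - _]addrC addrA.
rewrite exchange_big [X in _ + X]exchange_big /= /dotc -big_split /=.
apply: eq_bigr => j _; rewrite !mxE mulrDr; congr (_ + _).
  case: (eqVneq (src e) (tgt e)) => [st|st].
    rewrite st subrr mulr0 big1 // => i _.
    by rewrite !mxE st eqxx mul0r.
  rewrite (bigD1 (src e)) //= (bigD1 (tgt e)) /=; last by rewrite eq_sym.
  rewrite big1 => [|i /andP[/negPf is_ /negPf it]]; last first.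
    by rewrite !mxE (negPf st) is_ it mul0r.
  rewrite !mxE (negPf st) !eqxx eq_sym (negPf st).
  by rewrite addr0 mulrBr mulNr.
rewrite mulr_sumr; apply: eq_bigr => i _; rewrite !mxE.
by rewrite -mulrA mulrCA [_%:~R * _]mulrC.
Qed.

Lemma rigid_space_sub_flex : (rigid_space C E <= flex_space C E)%VS.
Proof.
apply/subvP => x /mem_rigid_space[c [S [skewS Hx]]].
rewrite memv_ker lfunE; apply/eqP/colP => e.
rewrite /= rigidity_fun_edge !Hx opprD addrACA subrr add0r -mulmxBr.
by rewrite dotc_skew // mxE.
Qed.

Lemma mech_dim_add_rigid_dim :
  (mech_dim C E + rigid_dim C E)%N = \dim (flex_space C E).
Proof.
apply: (dim_orthogonal_complement velocity_coords_inj rigid_space_sub_flex).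
exact: mem_mech_space.
Qed.

Lemma stress_dim_add_rank :
  (stress_dim C E + \dim (limg (rigidity_map C E)))%N = ne C.
Proof.
have dimR : \dim (fullv : {vspace 'cV[R]_(ne C)}) = ne C.
  by rewrite dimvf /dim /= muln1.
rewrite -[RHS]dimR.
apply: (@dim_orthogonal_complement _ _ _ idfun) (subvf _) _ => // w.
split=> [/mem_stress_space wO|[_ wO]]; last exact/mem_stress_space.
by split; rewrite ?memvf.
Qed.

Lemma dim_velocity :
  \dim {: ('M[R]_(d, nv C) * subvs_of E)%type} = (d * nv C + \dim E)%N.
Proof. by rewrite dimvf. Qed.

End Rigidity.

Theorem theorem2p10 (R : realType) (d : nat) (C : crystal_framework R d)
    (E : {vspace 'M[R]_d}) :
  (mech_dim C E)%:Z - (stress_dim C E)%:Z =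
    (d * nv C)%N%:Z + (\dim E)%:Z - (ne C)%:Z - (rigid_dim C E)%:Z.
Proof.
have rank_nullity := limg_ker_dim (rigidity_map C E) fullv.
rewrite capfv -/(flex_space C E) dim_velocity in rank_nullity.
rewrite -PoszD -rank_nullity -mech_dim_add_rigid_dim.
rewrite -[X in _ - Posz X - _](stress_dim_add_rank C E) !PoszD.
ring.
Qed.
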